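(* Let $(X,d)$ be a proper and complete Cat$(0)$ space with a fixed point $x_0$. Define a relation ${\bf b}_{V,x_0}$ on $(X,\mathcal{B}_C)$, where $\mathcal{B}_C$ is the bornology of subsets of $X$ with compact closure, by setting, for all $A,B\subseteq X$, $$A\,{\bf b}_{V,x_0}\,B\iff \exists (x_n)\subseteq A,\ (y_n)\subseteq B,\text{ and }\eta\in\partial X\text{ such that }\lim x_n=\lim y_n=\eta,$$ where the limits are taken in the visual compactification of $X$ constructed using the basepoint $x_0$. Then the triple $(X,\mathcal{B}_C,{\bf b}_{V,x_0})$ is a coarse proximity space whose boundary $\mathcal{U}_{{\bf b}_{V,x_0}}X$ is homeomorphic to the visual boundary $\partial X$.
   Context: Cat(0) spaces and the visual boundary. A metric space is proper if its closed bounded subsets are compact. A geodesic segment between $x$ and $y$ is an isometric embedding $\mu:[0,t]\to X$ with $\mu(0)=x$, $\mu(t)=y$; $X$ is geodesic if any two points are joined by one. A geodesic ray based at $x_0$ is a map $\gamma:[0,\infty)\to X$ with $\gamma(0)=x_0$ and $d(\gamma(t),\gamma(t'))=|t-t'|$ for all $t,t'$. A geodesic triangle $\Delta$ consists of three vertices and images of geodesic segments between the pairs of vertices; a comparison triangle is a Euclidean triangle in $\mathbb{R}^2$ with the same side lengths; for $x$ on the side of $\Delta$ between $a$ and $b$, $\bar x$ is the point of $\mathbb{R}^2$ with $d(a,x)=\|a'-\bar x\|$ and $d(x,b)=\|\bar x-b'\|$, where $a',b'$ are the corresponding vertices. A geodesic space $X$ is Cat(0) if for every geodesic triangle $\Delta$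 and all $x,y\in\Delta$, $d(x,y)\le\|\bar x-\bar y\|$ for all possible choices of $\bar x,\bar y$. In a Cat(0) space, $[x,y]$ denotes the unique image of a geodesic segment between $x$ and $y$. Let $\partial X$ be the set of geodesic rays in $X$ based at $x_0$ and $\overline{X}=X\cup\partial X$. For $\gamma\in\partial X$ and $R,\epsilon>0$ let $V(\gamma,R,\epsilon)=\{\alpha\in\partial X\mid d(\gamma(R),\alpha([0,\infty)))<\epsilon\}$, $C(\gamma,R,\epsilon)=\{x\in X\mid d(\gamma(R),[x_0,x])<\epsilon\}$, $D(\gamma,R,\epsilon)=V(\gamma,R,\epsilon)\cup C(\gamma,R,\epsilon)$. The sets $D(\gamma,R,\epsilon)$ together with the open metric balls of $X$ form a basis of a compact Hausdorff topology on $\overline{X}$; $\overline{X}$ with this topology is the visual compactification and $\partial X$ (subspace topology) the visual boundary. Coarse proximity spaces. A bornology $\mathcal{B}$ on a set $X$ is a family of subsets containing all singletons and closed under subsets and finite unions; its members are called bounded. A coarse proximity on $(X,\mathcal{B})$ is a relation ${\bf b}$ on the power set of $X$ such that for all $A,B,C\subseteq X$: (1) $A{\bf b}B\Rightarrow B{\bf b}A$; (2) $A{\bf b}B\Rightarrow A,B\notin\mathcal{B}$; (3) $A\cap B\notin\mathcal{B}\Rightarrow A{\bf b}B$; (4) $(A\cup B){\bf b}C\iff A{\bf b}C$ or $B{\bf b}C$; (5) $A\bar{\bf b}B\Rightarrow\exists E\subseteq X$ with $A\bar{\bf b}E$ and $(X\setminus E)\bar{\bf b}B$ (a bar denotes negation).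 Then $(X,\mathcal{B},{\bf b})$ is a coarse proximity space. Proximities and clusters. A proximity on a set $X$ is a relation $\delta$ on the power set with: (1) $A\delta B\Rightarrow B\delta A$; (2) $A\delta B\Rightarrow A,B\ne\emptyset$; (3) $A\cap B\neq\emptyset\Rightarrow A\delta B$; (4) $A\delta(B\cup C)\iff A\delta B$ or $A\delta C$; (5) $A\bar\delta B\Rightarrow\exists E\subseteq X$ with $A\bar\delta E$ and $(X\setminus E)\bar\delta B$. It is separated if $\{x\}\delta\{y\}\iff x=y$. It induces the topology in which $A$ is closed iff ($A\delta\{x\}\Rightarrow x\in A$). A cluster in $(X,\delta)$ is a collection $\sigma$ of subsets of $X$ such that: $A,B\in\sigma\Rightarrow A\delta B$; if $A\delta B$ for all $B\in\sigma$ then $A\in\sigma$; if $A\cup B\in\sigma$ then $A\in\sigma$ or $B\in\sigma$. For $\delta$ separated, the Smirnov compactification $\mathfrak{X}$ is the set of all clusters with the proximity $\mathcal{A}\delta^*\mathcal{C}$ iff $A\delta C$ for all $A,C\subseteq X$ such that $A\in\sigma$ for all $\sigma\in\mathcal{A}$ and $C\in\sigma$ for all $\sigma\in\mathcal{C}$; it is compact Hausdorff. Boundary. For a coarse proximity space $(X,\mathcal{B},{\bf b})$, the discrete extension is the separated proximity $A\delta_{dis}B\iff A\cap B\ne\emptyset$ or $A{\bf b}B$. The boundary $\mathcal{U}_{\bf b}X$ is the set of clusters in $(X,\delta_{dis})$ containing no bounded set, with the topology inherited from the Smirnov compactification of $(X,\delta_{dis})$. *)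

(* Defs.v *)
From HB Require Import structures.
From mathcomp Require Import all_boot all_order all_algebra.
From mathcomp Require Import all_classical all_reals all_analysis.
Set Implicit Arguments.
Unset Strict Implicit.
Unset Printing Implicit Defensive.
Import Order.TTheory GRing.Theory Num.Theory.
Local Open Scope classical_set_scope.
Local Open Scope ring_scope.

(** * Cat(0) spaces *)

Definition proper_metric (R : realType) (X : metricType R) : Prop :=
  forall A : set X, closed A ->
    (exists M : R, forall x y, A x -> A y -> mdist x y <= M) -> compact A.

Definition complete_metric (R : realType) (X : metricType R) : Prop :=
  forall F : set_system X, ProperFilter F -> cauchy F ->
    exists x : X, F --> x.

(* Only the restriction of [mu] to [0, t] matters. *)
Definition is_geodesic (R : realType) (X : metricType R)
    (x y : X) (t : R) (mu : R -> X) : Prop :=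
  [/\ 0 <= t, mu 0 = x, mu t = y &
    forall s s', 0 <= s <= t -> 0 <= s' <= t ->
      mdist (mu s) (mu s') = `|s - s'|].

Definition is_segment (R : realType) (X : metricType R)
    (x y : X) (S : set X) : Prop :=
  exists t mu, is_geodesic x y t mu /\ S = mu @` [set s | 0 <= s <= t].

Definition geodesic_space (R : realType) (X : metricType R) : Prop :=
  forall x y : X, exists t mu, is_geodesic x y t mu.

(* The norm provided by the library on [R * R] is the sup norm. *)
Definition eucl_dist (R : realType) (p q : R * R) : R :=
  Num.sqrt ((p.1 - q.1) ^+ 2 + (p.2 - q.2) ^+ 2).

(* The vertices are [v 0], [v 1], [v 2]; the side [S i] joins [v i] to
   [v (i + 1 mod 3)]. *)
Definition geodesic_triangle (R : realType) (X : metricType R)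
    (v : 'I_3 -> X) (S : 'I_3 -> set X) : Prop :=
  forall i, is_segment (v i) (v (ordS i)) (S i).

Definition comparison_triangle (R : realType) (X : metricType R)
    (v : 'I_3 -> X) (w : 'I_3 -> R * R) : Prop :=
  forall i j, eucl_dist (w i) (w j) = mdist (v i) (v j).

Definition comparison_point (R : realType) (X : metricType R)
    (v : 'I_3 -> X) (w : 'I_3 -> R * R) (i : 'I_3) (x : X) (x' : R * R) :=
  mdist (v i) x = eucl_dist (w i) x' /\
  mdist x (v (ordS i)) = eucl_dist x' (w (ordS i)).

Definition cat0 (R : realType) (X : metricType R) : Prop :=
  geodesic_space X /\
  forall (v : 'I_3 -> X) (S : 'I_3 -> set X) (w : 'I_3 -> R * R),
    geodesic_triangle v S -> comparison_triangle v w ->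
    forall (i j : 'I_3) (x y : X) (x' y' : R * R), S i x -> S j y ->
      comparison_point v w i x x' -> comparison_point v w j y y' ->
      mdist x y <= eucl_dist x' y'.

(** * The visual compactification and the visual boundary *)

(* In a Cat(0) space this is the unique image of a geodesic from [x] to [y]. *)
Definition segment (R : realType) (X : metricType R) (x y : X) : set X :=
  \bigcup_(S in is_segment x y) S.

Definition dist_to_set (R : realType) (X : metricType R)
    (x : X) (A : set X) : R :=
  inf [set mdist x a | a in A].

Definition is_ray (R : realType) (X : metricType R) (x0 : X)
    (gamma : {nonneg R} -> X) : Prop :=
  gamma 0%:nng = x0 /\
  forall s t, mdist (gamma s) (gamma t) = `|s%:num - t%:num|.

Definition visual_boundary (R : realType) (X : metricType R) (x0 : X) : Type :=
  {gamma : {nonneg R} -> X | is_ray x0 gamma}.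

HB.instance Definition _ (R : realType) (X : metricType R) (x0 : X) :=
  gen_eqMixin (visual_boundary x0).
HB.instance Definition _ (R : realType) (X : metricType R) (x0 : X) :=
  gen_choiceMixin (visual_boundary x0).

Definition visual_compactification (R : realType) (X : metricType R) (x0 : X) :
  Type := (X + visual_boundary x0)%type.

HB.instance Definition _ (R : realType) (X : metricType R) (x0 : X) :=
  gen_eqMixin (visual_compactification x0).
HB.instance Definition _ (R : realType) (X : metricType R) (x0 : X) :=
  gen_choiceMixin (visual_compactification x0).

Definition point_incl (R : realType) (X : metricType R) (x0 : X) (x : X) :
  visual_compactification x0 := inl x.
Definition ray_incl (R : realType) (X : metricType R) (x0 : X)
  (gamma : visual_boundary x0) : visual_compactification x0 := inr gamma.

Definition ray_nbhs (R : realType) (X : metricType R) (x0 : X)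
    (gamma : visual_boundary x0) (r e : {posnum R}) :
    set (visual_boundary x0) :=
  [set alpha | dist_to_set (sval gamma r%:num%:nng) (range (sval alpha))
               < e%:num].

Definition cone_nbhs (R : realType) (X : metricType R) (x0 : X)
    (gamma : visual_boundary x0) (r e : {posnum R}) : set X :=
  [set x | dist_to_set (sval gamma r%:num%:nng) (segment x0 x) < e%:num].

Definition visual_nbhs (R : realType) (X : metricType R) (x0 : X)
    (gamma : visual_boundary x0) (r e : {posnum R}) :
    set (visual_compactification x0) :=
  (@ray_incl R X x0 @` ray_nbhs gamma r e) `|`
  (@point_incl R X x0 @` cone_nbhs gamma r e).

Definition visual_basis (R : realType) (X : metricType R) (x0 : X) :
    set (set (visual_compactification x0)) :=
  [set U | (exists (gamma : visual_boundary x0) (r e : {posnum R}),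
              U = visual_nbhs gamma r e) \/
           (exists (x : X) (e : {posnum R}),
              U = @point_incl R X x0 @` ball x e%:num)].

(* The topology generated by [visual_basis].  On a proper Cat(0) space this
   family is a basis, so that finite intersections of its members bring in no
   further open set; generating the topology makes it available without
   assumption on [X]. *)
HB.instance Definition _ (R : realType) (X : metricType R) (x0 : X) :=
  isSubBaseTopological.Build (visual_compactification x0)
    (@visual_basis R X x0) id.

HB.instance Definition _ (R : realType) (X : metricType R) (x0 : X) :=
  Topological.copy (visual_boundary x0)
    (initial_topology (@ray_incl R X x0)).

(** * Coarse proximity spaces *)

(* [set0] is the union of the empty family. *)
Definition is_bornology (T : Type) (B : set (set T)) : Prop :=
  [/\ forall x, B [set x],
      forall A C, A `<=` C -> B C -> B A,
      B set0 &
      forall A C, B A -> B C -> B (A `|` C)].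

Record coarse_proximity_space (T : Type) (B : set (set T))
    (b : set T -> set T -> Prop) : Prop := {
  cp_bornology : is_bornology B ;
  cp_sym : forall A C, b A C -> b C A ;
  cp_unbounded : forall A C, b A C -> ~ B A /\ ~ B C ;
  cp_meet : forall A C, ~ B (A `&` C) -> b A C ;
  cp_union : forall A C D, b (A `|` C) D <-> b A D \/ b C D ;
  cp_strong : forall A C, ~ b A C ->
    exists E, ~ b A E /\ ~ b (~` E) C
}.

(** * Proximities and the Smirnov compactification *)

Record proximity (T : Type) (delta : set T -> set T -> Prop) : Prop := {
  prox_sym : forall A C, delta A C -> delta C A ;
  prox_neq0 : forall A C, delta A C -> A !=set0 /\ C !=set0 ;
  prox_meet : forall A C, A `&` C !=set0 -> delta A C ;
  prox_union : forall A C D, delta A (C `|` D) <-> delta A C \/ delta A D ;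
  prox_strong : forall A C, ~ delta A C ->
    exists E, ~ delta A E /\ ~ delta (~` E) C
}.

Definition separated_proximity (T : Type) (delta : set T -> set T -> Prop) :=
  proximity delta /\ forall x y, delta [set x] [set y] <-> x = y.

Definition proximity_closed (T : Type) (delta : set T -> set T -> Prop)
    (A : set T) : Prop :=
  forall x, delta A [set x] -> A x.

Definition proximity_open (T : Type) (delta : set T -> set T -> Prop) :
    set (set T) :=
  [set U | proximity_closed delta (~` U)].

Lemma prox_mono (T : Type) (delta : set T -> set T -> Prop) :
  proximity delta -> forall A A' C C',
  A `<=` A' -> C `<=` C' -> delta A C -> delta A' C'.
Proof.
move=> h A A' C C' AA' CC' AC.
have right D E E' : E `<=` E' -> delta D E -> delta D E'.
  move=> EE' DE; have <- : E `|` E' = E' by apply/setUidPr.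
  by apply/(prox_union h); left.
apply: (right _ C) => //; apply: (prox_sym h); apply: (right _ A) => //.
exact: (prox_sym h).
Qed.

Lemma proximity_openT (T : Type) (delta : set T -> set T -> Prop) :
  proximity delta -> proximity_open delta setT.
Proof.
by move=> h x; rewrite setCT => /(prox_neq0 h)[[]].
Qed.

Lemma proximity_openI (T : Type) (delta : set T -> set T -> Prop) :
  proximity delta -> setI_closed (proximity_open delta).
Proof.
move=> h U V oU oV x; rewrite setCI => /(prox_sym h)/(prox_union h)[] /(prox_sym h).
  by move/oU; left.
by move/oV; right.
Qed.

Lemma proximity_open_bigU (T : Type) (delta : set T -> set T -> Prop) :
  proximity delta -> forall (I : Type) (f : I -> set T),
  (forall i, proximity_open delta (f i)) ->
  proximity_open delta (\bigcup_i f i).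
Proof.
move=> h I f fo x fx [i _ fix_]; apply: (fo i x) fix_.
by apply: (prox_mono h) fx => // y fy fiy; apply: fy; exists i.
Qed.

Record cluster (T : Type) (delta : set T -> set T -> Prop)
    (sigma : set (set T)) : Prop := {
  cluster_near : forall A C, sigma A -> sigma C -> delta A C ;
  cluster_max : forall A, (forall C, sigma C -> delta A C) -> sigma A ;
  cluster_union : forall A C, sigma (A `|` C) -> sigma A \/ sigma C
}.

Definition smirnov (T : Type) (delta : set T -> set T -> Prop)
    (h : separated_proximity delta) : Type :=
  {sigma : set (set T) | cluster delta sigma}.

Definition smirnov_prox (T : Type) (delta : set T -> set T -> Prop)
    (h : separated_proximity delta) (P Q : set (smirnov h)) : Prop :=
  forall A C, (forall sigma, P sigma -> sval sigma A) ->
              (forall sigma, Q sigma -> sval sigma C) -> delta A C.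

Lemma cluster_up (T : Type) (delta : set T -> set T -> Prop) sigma A C :
  proximity delta -> cluster delta sigma ->
  A `<=` C -> sigma A -> sigma C.
Proof.
move=> h cs AC sA; apply: (cluster_max cs) => D sD.
by apply: (prox_mono h) (cluster_near cs sA sD).
Qed.

Lemma cluster_setC (T : Type) (delta : set T -> set T -> Prop) sigma E :
  proximity delta -> cluster delta sigma -> sigma E \/ sigma (~` E).
Proof.
move=> h cs; apply: (cluster_union cs); rewrite setUv.
apply: (cluster_max cs) => C sC; apply: (prox_meet h); rewrite setTI.
by have [] := prox_neq0 h (cluster_near cs sC sC).
Qed.

Lemma smirnov_proximity (T : Type) (delta : set T -> set T -> Prop)
  (h : separated_proximity delta) : proximity (@smirnov_prox T delta h).
Proof.
have [hd _] := h.
have sym (P Q : set (smirnov h)) : smirnov_prox P Q -> smirnov_prox Q P.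
  by move=> PQ A C QA PC; apply: (prox_sym hd); exact: PQ.
have neq0 (P Q : set (smirnov h)) : smirnov_prox P Q -> P !=set0.
  move=> PQ; apply: contrapT => P0.
  have [] := prox_neq0 hd (PQ set0 setT _ _); last by case.
  - by move=> s Ps; case: P0; exists s.
  - move=> [s cs] _ /=; have [] := cluster_setC setT hd cs => // sC.
    exact: (cluster_up hd cs _ sC).
have sep (P Q : set (smirnov h)) : ~ smirnov_prox P Q -> exists A C,
    [/\ forall s, P s -> sval s A, forall s, Q s -> sval s C & ~ delta A C].
  move=> /existsNP[A] /existsNP[C] /not_implyP[PA] /not_implyP[QC] AC.
  by exists A, C.
split => //.
- by move=> P Q PQ; split; [exact: neq0 PQ | exact: neq0 (sym _ _ PQ)].
- move=> P Q [s [Ps Qs]] A C PA QC.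
  exact: (cluster_near (svalP s) (PA _ Ps) (QC _ Qs)).
- move=> P Q S; split; last first.
    by move=> [PQ|PS] A C PA QSC; [apply: PQ | apply: PS] => // s ?;
       apply: QSC; [left | right].
  move=> PQS; apply: contrapT => /not_orP[/sep[A [C [PA QC AC]]]].
  move=> /sep[A' [D [PA' SD A'D]]].
  have [E [CE EA]] := prox_strong hd (fun x => AC (prox_sym hd x)).
  have [F [DF FA']] := prox_strong hd (fun x => A'D (prox_sym hd x)).
  have PEF s : P s -> sval s (E `&` F).
    move=> Ps; have cs := svalP s.
    have [//|] := cluster_setC (E `&` F) hd cs.
    rewrite setCI => /(cluster_union cs)[sE|sF].
      by case: EA; exact: (cluster_near cs sE (PA _ Ps)).
    by case: FA'; exact: (cluster_near cs sF (PA' _ Ps)).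
  have : delta (E `&` F) (C `|` D).
    apply: PQS => // s [Qs|Ss].
      by apply: (cluster_up hd (svalP s) _ (QC _ Qs)); exact: subsetUl.
    by apply: (cluster_up hd (svalP s) _ (SD _ Ss)); exact: subsetUr.
  move=> /(prox_union hd)[] /(prox_sym hd).
    by move=> x; apply: CE; apply: (prox_mono hd) x => // y [].
  by move=> x; apply: DF; apply: (prox_mono hd) x => // y [].
- move=> P Q /sep[A [C [PA QC AC]]].
  have [E [AE EC]] := prox_strong hd AC.
  exists [set s | sval s E]; split.
    by move=> /(_ A E PA) AE'; apply/AE/AE'.
  move=> /(_ (~` E) C) EC'; apply/EC/EC' => // s sE.
  by have [] := cluster_setC E hd (svalP s).
Qed.

HB.instance Definition _ (T : Type) (delta : set T -> set T -> Prop)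
  (h : separated_proximity delta) := gen_eqMixin (smirnov h).
HB.instance Definition _ (T : Type) (delta : set T -> set T -> Prop)
  (h : separated_proximity delta) := gen_choiceMixin (smirnov h).
HB.instance Definition _ (T : Type) (delta : set T -> set T -> Prop)
  (h : separated_proximity delta) :=
  isOpenTopological.Build (smirnov h)
    (proximity_openT (smirnov_proximity h))
    (proximity_openI (smirnov_proximity h))
    (proximity_open_bigU (smirnov_proximity h)).

(** * The boundary of a coarse proximity space *)

Definition discrete_extension (T : Type) (b : set T -> set T -> Prop)
    (A C : set T) : Prop :=
  A `&` C !=set0 \/ b A C.

Lemma discrete_extension_separated (T : Type) (B : set (set T))
  (b : set T -> set T -> Prop) :
  coarse_proximity_space B b -> separated_proximity (discrete_extension b).
Proof.
move=> h; have [B1 Bsub B0 BU] := cp_bornology h.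
have mono A D D' : D `<=` D' -> b D A -> b D' A.
  move=> DD' DA; have <- : D `|` D' = D' by apply/setUidPr.
  by apply/(cp_union h); left.
split; last first.
  move=> x y; split => [[[z [-> ->]]//|]|->]; last by left; exists y.
  by move=> /(cp_unbounded h)[/(_ (B1 x))].
have neq0 A C : b A C -> A !=set0.
  move=> /(cp_unbounded h)[BA _]; apply/set0P/eqP => A0.
  by apply: BA; rewrite A0.
split.
- by move=> A C [AC|/(cp_sym h) CA]; [left; rewrite setIC | right].
- move=> A C [[x [Ax Cx]]|AC]; first by split; exists x.
  by split; [exact: neq0 AC | exact: neq0 (cp_sym h AC)].
- by move=> A C AC; left.
- move=> A C D; split.
    move=> [[x [Ax [Cx|Dx]]]|/(cp_sym h)/(cp_union h)[] /(cp_sym h) ACD].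
    + by left; left; exists x.
    + by right; left; exists x.
    + by left; right.
    + by right; right.
  move=> [[[x [Ax Cx]]|AC]|[[x [Ax Dx]]|AD]].
  + by left; exists x; split => //; left.
  + by right; apply/(cp_sym h)/(cp_union h); left; exact: (cp_sym h).
  + by left; exists x; split => //; right.
  + by right; apply/(cp_sym h)/(cp_union h); right; exact: (cp_sym h).
- move=> A C /not_orP[AC0 nAC].
  have [E [AE EC]] := cp_strong h nAC.
  exists ((E `|` C) `\` A); split => -[].
  + by move=> [x [Ax [_ nAx]]].
  + move=> /(cp_sym h) bA.
    have /(cp_union h)[] : b (E `|` C) A by apply: mono bA => x [].
      by move/(cp_sym h).
    by move/(cp_sym h).
  + move=> [x [nx Cx]]; apply: nx; split; first by right.
    by move=> Ax; apply: AC0; exists x.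
  + move=> bC; have /(cp_union h)[//|//] : b (A `|` ~` E) C.
    apply: mono bC => x nx; have [Ax|nAx] := pselect (A x); first by left.
    by right => Ex; apply: nx; split => //; left.
Qed.

Definition cp_boundary (T : Type) (B : set (set T))
    (b : set T -> set T -> Prop) (h : coarse_proximity_space B b) :
    set (smirnov (discrete_extension_separated h)) :=
  [set sigma | forall A, sval sigma A -> ~ B A].
Arguments cp_boundary {T B b} h _.

(** * The visual coarse proximity *)

Definition relatively_compact (X : topologicalType) : set (set X) :=
  [set A | compact (closure A)].

Definition visual_proximity (R : realType) (X : metricType R) (x0 : X)
    (A B : set X) : Prop :=
  exists (x y : nat -> X) (eta : visual_boundary x0),
    [/\ forall n, A (x n), forall n, B (y n),
        (fun n => point_incl x0 (x n)) @ \oo --> ray_incl eta &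
        (fun n => point_incl x0 (y n)) @ \oo --> ray_incl eta].

Definition homeomorphic (S T : topologicalType) : Prop :=
  exists (f : S -> T) (g : T -> S),
    [/\ cancel f g, cancel g f, continuous f & continuous g].

(* Main.v *)
Require Import Defs.
From mathcomp Require Import all_boot all_order all_algebra.
From mathcomp Require Import all_classical all_reals all_analysis.
From mathcomp Require Import finmap ring lra.

(** Every point [xi] of the visual compactification determines a path issuing
    from [x0]: the ray itself if [xi] is at infinity, and the geodesic from [x0]
    to [xi] otherwise.  Say that two such paths fellow-travel up to [r] if both
    are geodesic on [[0, r]] and they are at distance less than [1] at time
    [r].  The whole proof is written in terms of this relation.

    The only consequence of the Cat(0) inequality that is used is the
    comparison in an isosceles triangle ([cat0_contraction]): two geodesics
    issuing from [x0] satisfy [d (c s) (c' s) <= s / r * d (c r) (c' r)] for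
    [s <= r].  It makes fellow-travelling up to [r] decreasing in [r], and
    composing two pairs that fellow-travel up to [2 * r] gives a pair that
    fellow-travels up to [r] ([fellow_travel_trans]).  So the fellow-travel
    relations behave like the entourages of a uniformity near infinity, with
    [r] in the role of a scale, and they describe both structures at hand:
    - the neighbourhoods of a ray [eta] in the compactification are the sets
      containing all the points whose path fellow-travels with [eta] up to some
      [r] ([nbhs_rayP]);
    - [A] and [B] are close for the visual proximity iff for every [r] some
      points of [A] and of [B] have geodesics that fellow-travel up to [r]
      ([visual_proximityP]).
    The existence of a common limit ray in the second point comes from
    properness: the points at time [r] of the geodesics to an unbounded family
    stay in a compact ball, hence converge along an ultrafilter, and the limits
    for all [r] form a ray ([ultralimit_ray]).  The axioms of a coarse proximity
    then become formal; the strong axiom separates [A] from [B] by the set of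
    points whose geodesic fellow-travels, at scale [2 * r], with one of [B].

    A ray [eta] gives the cluster of all the sets that have [eta] as a limit
    point ([direction_cluster]).  Distinct rays diverge, so this is injective.
    Conversely a cluster without bounded member contains an ultrafilter
    ([cluster_ultrafilter]); the limit ray of that ultrafilter adheres to every
    member of the cluster, which is therefore included in, hence equal to, the
    cluster of that ray ([direction_cluster_surj]).  Finally, the sets of
    clusters that avoid a given set [A] form a basis of the Smirnov
    topology, and avoiding the complement of a cone around [eta] means pointing
    into that cone, so that the bijection is a homeomorphism. *)

Set Implicit Arguments.
Unset Strict Implicit.
Unset Printing Implicit Defensive.
Import Order.TTheory GRing.Theory Num.Theory.
Local Open Scope classical_set_scope.
Local Open Scope ring_scope.

(** * Geodesics issuing from a point *)

Section Geodesics.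
Context (R : realType) (X : metricType R).
Implicit Types (x y : X) (r s t : R) (c : R -> X).

Lemma eucl_dist_scale (a b : R) (p : R * R) :
  eucl_dist (a * p.1, a * p.2) (b * p.1, b * p.2) = `|a - b| * eucl_dist p (0, 0).
Proof.
rewrite /eucl_dist /= !subr0 -sqrtr_sqr -sqrtrM ?sqr_ge0//.
by congr Num.sqrt; ring.
Qed.

Lemma eucl_distC (p q : R * R) : eucl_dist p q = eucl_dist q p.
Proof. by rewrite /eucl_dist; congr Num.sqrt; ring. Qed.

Lemma eucl_distxx (p : R * R) : eucl_dist p p = 0.
Proof. by rewrite /eucl_dist !subrr expr0n /= addr0 sqrtr0. Qed.

(** Paths are total functions on the reals, so that the geodesics of different
    lengths and the rays issuing from [x0] all have the same type. *)
Definition geodesic_upto (x0 : X) r c := is_geodesic x0 (c r) r c.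

Lemma geodesic_upto_le x0 r s c :
  0 <= s <= r -> geodesic_upto x0 r c -> geodesic_upto x0 s c.
Proof.
move=> /andP[s0 sr] [r0 c0 _ cd]; split=> // u v /andP[u0 us] /andP[v0 vs].
by apply: cd; rewrite ?u0 ?v0 /= ?(le_trans us) ?(le_trans vs).
Qed.

Lemma geodesic_upto_dist x0 r c s : geodesic_upto x0 r c -> 0 <= s <= r ->
  mdist x0 (c s) = s.
Proof.
move=> [r0 c0 _ cd] sr; have /andP[s0 _] := sr.
by rewrite -c0 cd ?lexx// sub0r normrN ger0_norm.
Qed.

Lemma geodesic_upto_segment x0 r c :
  geodesic_upto x0 r c -> is_segment x0 (c r) (c @` [set s | 0 <= s <= r]).
Proof. by exists r, c. Qed.

Lemma geodesic_upto_segment_rev x0 r c :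
  geodesic_upto x0 r c -> is_segment (c r) x0 (c @` [set s | 0 <= s <= r]).
Proof.
move=> [r0 c0 _ cd]; exists r, (fun s => c (r - s)); split.
  split; rewrite ?subr0 ?subrr// => s s' /andP[s0 sr] /andP[s0' sr'].
  rewrite cd; last 2 first.
  - by rewrite subr_ge0 sr lerBlDr lerDl.
  - by rewrite subr_ge0 sr' lerBlDr lerDl.
  by rewrite distrC; congr `| _ |; ring.
apply/seteqP; split=> [_ [s /= /andP[s0 sr] <-]|_ [s /= /andP[s0 sr] <-]].
  by exists (r - s); rewrite /= ?subKr// subr_ge0 sr lerBlDr lerDl.
by exists (r - s); rewrite //= subr_ge0 sr lerBlDr lerDl.
Qed.

(** The triangle with vertices [x0], [c r], [c' r] is isosceles, so it has an
    explicit comparison triangle, symmetric about the first axis; there the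
    points [s / r] of the way along the equal sides are at distance
    [s / r * d (c r) (c' r)] by similarity. *)
Lemma cat0_contraction x0 r s c c' : cat0 X ->
  geodesic_upto x0 r c -> geodesic_upto x0 r c' -> 0 < r -> 0 <= s <= r ->
  mdist (c s) (c' s) <= s / r * mdist (c r) (c' r).
Proof.
move=> [Xgeod Xcat0] gc gc' r0 sr; have /andP[s0 ler] := sr.
have rn0 : r != 0 by rewrite gt_eqF.
set d := mdist _ (c' r).
have d0 : 0 <= d by exact: mdist_ge0.
have rr : 0 <= r <= r by rewrite lexx ltW.
have d2r : d <= 2 * r.
  have := metric_triangle (c r) x0 (c' r).
  rewrite (metric_sym (c r) x0) (geodesic_upto_dist gc rr).
  by rewrite (geodesic_upto_dist gc' rr) -/d; lra.
(* [h] is the height of the isosceles triangle of sides [r], [r] and base [d]. *)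
pose h := Num.sqrt (r ^+ 2 - (d / 2) ^+ 2).
have h2 : h ^+ 2 = r ^+ 2 - (d / 2) ^+ 2 by rewrite sqr_sqrtr//; nra.
pose w1 : R * R := (h, d / 2); pose w2 : R * R := (h, - (d / 2)).
have w10 : eucl_dist w1 (0, 0) = r.
  by rewrite /eucl_dist /= !subr0 h2 subrK sqrtr_sqr gtr0_norm.
have w20 : eucl_dist w2 (0, 0) = r.
  by rewrite /eucl_dist /= !subr0 h2 sqrrN subrK sqrtr_sqr gtr0_norm.
have w12 : eucl_dist w1 w2 = d.
  rewrite /eucl_dist /= subrr expr0n /= add0r sqrtr_sqr opprK -splitr.
  by rewrite ger0_norm.
pose v (i : 'I_3) := nth x0 [:: x0; c r; c' r] i.
pose w (i : 'I_3) := nth (0, 0) [:: (0, 0); w1; w2] i.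
have [t1 [m1 g1]] := Xgeod (c r) (c' r).
pose side c := c @` [set s | 0 <= s <= r].
pose S (i : 'I_3) := nth set0 [:: side c; m1 @` [set s | 0 <= s <= t1]; side c'] i.
have triS : geodesic_triangle v S.
  case=> -[|[|[|//]]] i3; rewrite /v /S /=.
  - exact: geodesic_upto_segment.
  - by exists t1, m1.
  - exact: geodesic_upto_segment_rev.
have cr0 : mdist x0 (c r) = r by exact: geodesic_upto_dist gc _.
have cr0' : mdist x0 (c' r) = r by exact: geodesic_upto_dist gc' _.
have cmp : comparison_triangle v w.
  case=> -[|[|[|//]]] i3 [] [|[|[|//]]] j3; rewrite /v /w /=;
    rewrite ?mdistxx ?eucl_distxx//.
  - by rewrite eucl_distC w10.
  - by rewrite eucl_distC w20.
  - by rewrite w10 metric_sym.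
  - by rewrite w20 metric_sym.
  - by rewrite eucl_distC w12 metric_sym.
pose k := s / r.
have k0 : 0 <= k by rewrite divr_ge0// ltW.
have k1 : k <= 1 by rewrite ler_pdivrMr// mul1r.
have kr : k * r = s by rewrite divfK.
have scale0 (p : R * R) : eucl_dist p (0, 0) = r ->
    eucl_dist (0, 0) (k * p.1, k * p.2) = s.
  move=> pr; have -> : (0, 0) = (0 * p.1, 0 * p.2) :> R * R by rewrite !mul0r.
  by rewrite eucl_distC eucl_dist_scale subr0 ger0_norm// pr.
have scale1 (p : R * R) : eucl_dist p (0, 0) = r ->
    eucl_dist (k * p.1, k * p.2) p = r - s.
  move=> pr; have {3}-> : p = (1 * p.1, 1 * p.2) by rewrite !mul1r; case: (p).
  rewrite eucl_dist_scale /= pr distrC.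
  by rewrite ger0_norm ?subr_ge0// mulrBl mul1r kr.
have cdr (b : R -> X) : geodesic_upto x0 r b -> mdist (b s) (b r) = r - s.
  by move=> [_ _ _ ->//]; rewrite distrC ger0_norm// subr_ge0.
have := Xcat0 v S w triS cmp ord0 ord_max (c s) (c' s)
  (k * w1.1, k * w1.2) (k * w2.1, k * w2.2).
have -> : eucl_dist (k * w1.1, k * w1.2) (k * w2.1, k * w2.2) = k * d.
  rewrite /eucl_dist /= subrr expr0n /= add0r mulrN opprK sqrtr_sqr.
  by rewrite -mulrDr -splitr ger0_norm// mulr_ge0.
apply.
- by exists s.
- by exists s.
- split; rewrite /v /w /=.
    by rewrite (geodesic_upto_dist gc)// -(scale0 w1).
  by rewrite cdr// -(scale1 w1).
- split; rewrite /v /w /=.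
    by rewrite metric_sym cdr// eucl_distC -(scale1 w2).
  by rewrite metric_sym (geodesic_upto_dist gc')// eucl_distC -(scale0 w2).
Qed.

End Geodesics.

(** * Fellow-travelling paths *)

Definition fellow_travel (R : realType) (X : metricType R) (x0 : X) (r : R)
    (c c' : R -> X) : Prop :=
  [/\ geodesic_upto x0 r c, geodesic_upto x0 r c' & mdist (c r) (c' r) < 1].

Section FellowTravel.
Context (R : realType) (X : metricType R) (x0 : X) (hcat0 : cat0 X).
Implicit Types (x y : X) (r s t : R) (c : R -> X).
Local Notation fellow := (fellow_travel x0).

Lemma fellow_travel_refl r c : geodesic_upto x0 r c -> fellow r c c.
Proof. by move=> gc; split=> //; rewrite mdistxx. Qed.

Lemma fellow_travel_sym r c c' : fellow r c c' -> fellow r c' c.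
Proof. by move=> [gc gc' d]; split=> //; rewrite metric_sym. Qed.

Lemma fellow_travel_dist r s c c' : 0 < r -> 0 <= s <= r -> fellow r c c' ->
  mdist (c s) (c' s) <= s / r.
Proof.
move=> r0 /andP[s0 sr] [gc gc' d].
apply: le_trans (cat0_contraction hcat0 gc gc' r0 _) _; first by rewrite s0.
by rewrite ler_piMr ?(ltW d)// divr_ge0// ltW.
Qed.

Lemma fellow_travel_le r s c c' : 0 < s <= r -> fellow r c c' -> fellow s c c'.
Proof.
move=> /andP[s0 sr] f; have [gc gc' d] := f.
have r0 := lt_le_trans s0 sr; have sr' : 0 <= s <= r by rewrite ltW.
split; try exact: geodesic_upto_le sr' _.
apply: le_lt_trans (cat0_contraction hcat0 gc gc' r0 sr') _.
apply: le_lt_trans d; rewrite ler_piMl ?mdist_ge0// ler_pdivrMr// mul1r.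
exact: sr.
Qed.

(** At time [r] the contraction has halved the distances from time [2 * r], so
    the two of them add up to less than [1]. *)
Lemma fellow_travel_trans r c1 c2 c3 : 0 < r ->
  fellow (2 * r) c1 c2 -> fellow (2 * r) c2 c3 -> fellow r c1 c3.
Proof.
move=> r0 f12 f23.
have r20 : 0 < 2 * r by rewrite mulr_gt0.
have rr : 0 <= r <= 2 * r by apply/andP; split; lra.
have [g1 g2 d12] := f12; have [_ g3 d23] := f23.
split; try exact: geodesic_upto_le rr _.
apply: le_lt_trans (metric_triangle _ (c2 r) _) _.
have := cat0_contraction hcat0 g1 g2 r20 rr.
have := cat0_contraction hcat0 g2 g3 r20 rr.
have -> : r / (2 * r) = 2^-1 by field; rewrite gt_eqF.
lra.
Qed.

Lemma geodesic_unique r c c' : geodesic_upto x0 r c -> geodesic_upto x0 r c' ->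
  c r = c' r -> forall s, 0 <= s <= r -> c s = c' s.
Proof.
move=> gc gc' e s sr; have [r0 c0 _ _] := gc; have [_ c0' _ _] := gc'.
have [r_gt0|r_le0] := ltP 0 r; last first.
  have -> : s = 0 by apply/le_anti; case/andP: sr => -> /le_trans ->.
  by rewrite c0 c0'.
apply: mdist_positivity; apply/le_anti; rewrite mdist_ge0 andbT.
by have := cat0_contraction hcat0 gc gc' r_gt0 sr; rewrite e mdistxx mulr0.
Qed.

(** * The path from the base point to a point of the compactification *)

Lemma is_geodesic_dist x y t mu : is_geodesic x y t mu -> mdist x y = t.
Proof.
move=> [t0 <- <- md].
by rewrite md ?lexx ?t0// sub0r normrN ger0_norm.
Qed.

(** The path is kept constant beyond its end, so that it is a geodesic up to [r]
    exactly when [r] is at most the distance from [x0] to [x]. *)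
Definition geodesic_to (x : X) (t : R) : X :=
  xget (fun=> x0) [set mu | is_geodesic x0 x (mdist x0 x) mu]
    (Num.min t (mdist x0 x)).

Lemma geodesic_toP x : is_geodesic x0 x (mdist x0 x) (geodesic_to x).
Proof.
rewrite /geodesic_to; case: xgetP => [mu _ [d0 mu0 mux md]|no].
  split; rewrite ?minxx ?(min_idPl d0)// => s t /[dup] hs /andP[_ sx].
  by move=> /[dup] ht /andP[_ tx]; rewrite (min_idPl sx) (min_idPl tx) md.
have [t [mu g]] := hcat0.1 x0 x; case: (no mu).
by rewrite (is_geodesic_dist g).
Qed.

Lemma geodesic_to_end x : geodesic_to x (mdist x0 x) = x.
Proof. by have [] := geodesic_toP x. Qed.

Lemma geodesic_to_upto x r : 0 <= r ->
  geodesic_upto x0 r (geodesic_to x) <-> r <= mdist x0 x.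
Proof.
move=> r0; split=> [[_ _ _ gd]|rx].
  rewrite leNgt; apply/negP => xr; have xr' := ltW xr.
  have := gd r (mdist x0 x); rewrite r0 lexx mdist_ge0 xr' => /(_ isT isT).
  have -> : geodesic_to x r = geodesic_to x (mdist x0 x).
    by rewrite /geodesic_to minxx (min_idPr xr').
  by rewrite mdistxx => /esym/eqP; rewrite normr_eq0 subr_eq0 gt_eqF.
have := @geodesic_upto_le _ _ x0 (mdist x0 x) r (geodesic_to x).
rewrite r0 rx => /(_ isT); apply.
by rewrite /geodesic_upto geodesic_to_end; exact: geodesic_toP.
Qed.

Lemma segmentP x p : segment x0 x p <->
  exists2 t, 0 <= t <= mdist x0 x & p = geodesic_to x t.
Proof.
split=> [[_ [t [mu [g ->]]] [s /= st <-]]|[t tx ->]].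
  have [t0 m0 mt md] := g.
  have xt := is_geodesic_dist g.
  exists s; first by rewrite xt.
  apply: geodesic_unique st; first by rewrite /geodesic_upto mt.
    by apply/geodesic_to_upto; rewrite ?t0// xt.
  by rewrite mt -xt geodesic_to_end.
exists (geodesic_to x @` [set s | 0 <= s <= mdist x0 x]); last by exists t.
by exists (mdist x0 x), (geodesic_to x); split=> //; exact: geodesic_toP.
Qed.

(** The absolute value only serves to extend a ray to negative times. *)
Definition path_of (xi : visual_compactification x0) : R -> X :=
  match xi with
  | inl x => geodesic_to x
  | inr eta => fun t => sval eta `|t|%:nng
  end.

Local Notation ray eta := (path_of (ray_incl eta)).
Local Notation pt x := (path_of (point_incl x0 x)).

Lemma ray_dist (eta : visual_boundary x0) s t : 0 <= s -> 0 <= t ->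
  mdist (ray eta s) (ray eta t) = `|s - t|.
Proof.
by move=> s0 t0; have [_ /= ->] := svalP eta; rewrite /= (ger0_norm s0) (ger0_norm t0).
Qed.

Lemma ray0 (eta : visual_boundary x0) : ray eta 0 = x0.
Proof.
have [e0 _] := svalP eta; apply: etrans e0; congr (sval eta _).
by apply: val_inj; rewrite /= normr0.
Qed.

Lemma ray_upto (eta : visual_boundary x0) r :
  0 <= r -> geodesic_upto x0 r (ray eta).
Proof.
move=> r0; split=> //; first exact: ray0.
by move=> s t /andP[s0 _] /andP[t0 _]; exact: ray_dist.
Qed.

Lemma ray_eq (eta eta' : visual_boundary x0) :
  (forall t, 0 <= t -> ray eta t = ray eta' t) -> eta = eta'.
Proof.
case: eta eta' => [a ra] [a' ra'] e; apply: eq_exist; apply/funext => t.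
have -> : t = `|t%:num|%:nng by apply: val_inj; rewrite /= ger0_norm.
exact: e.
Qed.

Lemma geodesic_to_ray (eta : visual_boundary x0) r s : 0 <= s <= r ->
  pt (ray eta r) s = ray eta s.
Proof.
move=> sr; have r0 : 0 <= r by case/andP: sr => /le_trans; apply.
have dr : mdist x0 (ray eta r) = r.
  by rewrite (geodesic_upto_dist (ray_upto eta r0))// r0 lexx.
apply: geodesic_unique sr.
- by apply/geodesic_to_upto; rewrite ?dr.
- exact: ray_upto.
- by rewrite -[in X in pt _ X]dr /= geodesic_to_end.
Qed.


(** * Neighbourhoods of a boundary point in the compactification *)

Lemma dist_to_set_ltP x (A : set X) e : A !=set0 ->
  dist_to_set x A < e <-> exists2 a, A a & mdist x a < e.
Proof.
move=> [a0 Aa0].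
have hl : has_inf [set mdist x a | a in A].
  split; first by exists (mdist x a0), a0.
  by exists 0 => _ [a _ <-]; exact: mdist_ge0.
split=> [xe|[a Aa xa]].
  have d0 : 0 < e - dist_to_set x A by rewrite subr_gt0.
  have [_ [a Aa <-]] := inf_adherent d0 hl.
  by rewrite addrC subrK => ?; exists a.
apply: le_lt_trans xa; apply: ge_inf; first by have [] := hl.
by exists a.
Qed.

Lemma segment_neq0 x : segment x0 x !=set0.
Proof.
exists (geodesic_to x 0); apply/segmentP; exists 0 => //.
by rewrite lexx mdist_ge0.
Qed.

(** The rays and the points of the compactification in a basic neighbourhood are
    described by one and the same condition on their paths. *)
Lemma visual_nbhsP (gamma : visual_boundary x0) (r e : {posnum R}) xi :
  visual_nbhs gamma r e xi <-> exists t, [/\ 0 <= t,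
    geodesic_upto x0 t (path_of xi) &
    mdist (ray gamma r%:num) (path_of xi t) < e%:num].
Proof.
have rE : sval gamma r%:num%:nng = ray gamma r%:num.
  by congr (sval gamma _); apply: val_inj; rewrite /= ger0_norm.
case: xi => [x|eta].
  have n0 := segment_neq0 x.
  split=> [[[? _ //]|[y xy [yx]]]|[t [t0 gt d]]].
    move: xy; rewrite yx /cone_nbhs /= rE => /(dist_to_set_ltP _ _ n0)[p].
    move=> /segmentP[t /andP[t0 tx] ->] d; exists t; split=> //.
    exact/geodesic_to_upto.
  right; exists x => //; rewrite /cone_nbhs /= rE; apply/(dist_to_set_ltP _ _ n0).
  exists (geodesic_to x t) => //; apply/segmentP; exists t => //; rewrite t0.
  exact/geodesic_to_upto.
have n0 : range (sval eta) !=set0 by exists (sval eta 0%:nng), 0%:nng.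
split=> [[[a rea [ae]]|[? _ //]]|[t [t0 _ d]]].
  move: rea; rewrite ae /ray_nbhs /= rE => /(dist_to_set_ltP _ _ n0)[_ [t _ <-] d].
  exists t%:num; split=> //; first exact: ray_upto.
  by move: d; congr (mdist _ (sval eta _) < _); apply: val_inj; rewrite /= ger0_norm.
left; exists eta => //; rewrite /ray_nbhs /= rE; apply/(dist_to_set_ltP _ _ n0).
by exists (ray eta t) => //; exists `|t|%:nng.
Qed.

(** If [eta] passes within [e] of [gamma r] at time [t], then so does, at the
    same time, every path that fellow-travels with it up to a time that is large
    compared with [t], by contraction: this handles one member of the subbase,
    and the sets on the right are closed under finite intersection.
    Conversely, a path that passes within [1 / 2] of [eta (r + 1 / 2)] does so
    at a time [t > r], at which it is at distance less than [1] from
    [eta t]. *)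
Lemma nbhs_rayP (eta : visual_boundary x0) (A : set (visual_compactification x0)) :
  nbhs (ray_incl eta) A <->
  exists2 r, 0 < r & forall xi, fellow r (path_of xi) (ray eta) -> A xi.
Proof.
split=> [|[r r0 rA]].
  pose F (A : set (visual_compactification x0)) :=
    exists2 r, 0 < r & forall xi, fellow r (path_of xi) (ray eta) -> A xi.
  have FF : Filter F.
    split; first by exists 1.
    - move=> P Q [r r0 rP] [s s0 sQ]; exists (Num.max r s) => [|xi f].
        by rewrite lt_max r0.
      split; [apply: rP|apply: sQ]; apply: fellow_travel_le f.
        by rewrite r0 le_max lexx.
      by rewrite s0 le_max lexx orbT.
    - by move=> P Q PQ [r r0 rP]; exists r => // xi /rP /PQ.
  rewrite nbhsE => -[_ [[D Dfin <-]] [C DC Ceta] CA].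
  suff : F C by apply: filterS => xi Cxi; apply: CA; exists C.
  have [I Ib CE] := Dfin _ DC; rewrite -CE.
  apply: filter_bigI => U UI.
  have Ueta : U (ray_incl eta) by move: Ceta; rewrite -CE; apply.
  have := Ib U UI => /set_mem [[gamma [r [e UE]]]|[x [e UE]]]; last first.
    by move: Ueta; rewrite UE => -[].
  move: Ueta; rewrite UE => /visual_nbhsP[t [t0 _ d]].
  pose gap := e%:num - mdist (ray gamma r%:num) (ray eta t).
  have gap0 : 0 < gap by rewrite subr_gt0.
  have tgap : 0 <= t / gap by rewrite divr_ge0// ltW.
  (* Up to time [r'] this leaves a distance at most [t / r' < gap] at time [t]. *)
  exists (t + t / gap + 1); first by lra.
  move=> xi f; apply/visual_nbhsP; exists t.
  have tr : 0 <= t <= t + t / gap + 1 by apply/andP; split; lra.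
  split=> //; first by have [g _ _] := f; exact: geodesic_upto_le g.
  apply: le_lt_trans (metric_triangle _ (ray eta t) _) _.
  rewrite addrC -ltrBrDr -/gap metric_sym.
  have r'0 : 0 < t + t / gap + 1 by lra.
  apply: le_lt_trans (fellow_travel_dist r'0 tr f) _.
  rewrite ltr_pdivrMr// mulrDr mulrDr mulr1 (mulrC gap (t / gap)).
  rewrite divfK ?gt_eqF//; have : 0 <= gap * t by rewrite mulr_ge0// ltW.
  by lra.
have e0 : 0 < 2^-1 :> R by rewrite invr_gt0.
have r'0 : 0 < r + 2^-1 by rewrite addr_gt0.
pose e := PosNum e0; pose r' := PosNum r'0.
have r'E : r'%:num = r + 2^-1 by [].
rewrite nbhsE; exists (visual_nbhs eta r' e).
  split.
    exists [set visual_nbhs eta r' e]; last by rewrite bigcup_set1.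
    move=> _ ->; exists [fset (visual_nbhs eta r' e)]%fset.
      move=> U; rewrite inE => /eqP ->; apply: mem_set; left.
      by exists eta, r', e.
    by rewrite set_fset1 bigcap_set1.
  apply/visual_nbhsP; exists r'%:num; split=> //; first exact: ray_upto.
  by rewrite mdistxx.
move=> xi /visual_nbhsP[t [t0 gt d']]; apply: rA.
have d : mdist (ray eta (r + 2^-1)) (path_of xi t) < 2^-1 := d'.
have tr : `|r + 2^-1 - t| < 2^-1.
  have := metric_triangle x0 (path_of xi t) (ray eta (r + 2^-1)).
  have := metric_triangle x0 (ray eta (r + 2^-1)) (path_of xi t).
  rewrite (metric_sym (path_of _ _) (ray _ _)).
  rewrite (geodesic_upto_dist gt) ?t0 ?lexx//.
  rewrite (geodesic_upto_dist (ray_upto eta (ltW r'0))) ?lexx ?(ltW r'0)//.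
  by rewrite ltr_norml => ? ?; apply/andP; split; lra.
apply: (@fellow_travel_le t).
  by rewrite r0; move: tr; rewrite ltr_norml => /andP[? ?]; lra.
split=> //; first exact: ray_upto.
apply: le_lt_trans (metric_triangle _ (ray eta (r + 2^-1)) _) _.
rewrite (ray_dist _ (ltW r'0) t0) (metric_sym (path_of xi t)).
by move: d tr; lra.
Qed.

End FellowTravel.

(** * Bounded sets and limits along ultrafilters *)

Lemma ultra_fmap (I T : Type) (f : I -> T) (F : set_system I) :
  UltraFilter F -> UltraFilter (f @ F).
Proof.
move=> FU; split=> [|G GF FG]; first exact: fmap_proper_filter.
apply/seteqP; split=> // A GA.
have [//|FA] := in_ultra_setVsetC (f @^-1` A) FU.
have GA' : G (~` A) by exact: FG.
by have [t []] := filter_ex (filterI GA GA').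
Qed.

Section Compact.
Context (R : realType) (X : metricType R) (x0 : X) (hproper : proper_metric X).

Lemma mdist_closure_le (A : set X) (M : R) :
  (forall x, A x -> mdist x0 x <= M) ->
  forall x, closure A x -> mdist x0 x <= M + 1.
Proof.
move=> AM x /(_ (ball x 1)) => /(_ (nbhsx_ballx _ _ ltr01))[y [Ay]].
rewrite ballEmdist /= => xy.
have := metric_triangle x0 y x; have := AM y Ay; rewrite (metric_sym y).
lra.
Qed.

Lemma relatively_compactP (A : set X) :
  relatively_compact A <-> exists M : R, forall x, A x -> mdist x0 x <= M.
Proof.
split=> [Ac|[M AM]].
  suff [M HM] : exists M : nat, closure A `<=` [set x | mdist x0 x <= M%:R].
    by exists M%:R => x Ax; apply: HM; exact: subset_closure.
  have cov : near_covering (closure A) by apply/compact_near_coveringP.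
  have : \forall M \near \oo, closure A `<=` [set x | mdist x0 x <= M%:R].
    apply: (cov nat \oo (fun M x => mdist x0 x <= M%:R)) => x _.
    have [k kx] : exists k : nat, mdist x0 x + 1 <= k%:R.
      exists (Num.bound (mdist x0 x + 1)); apply/ltW/archi_boundP.
      by rewrite addr_ge0 ?mdist_ge0.
    exists (ball x 1, [set n | (k <= n)%N]).
      by split; [exact: nbhsx_ballx|exists k].
    move=> [y n] /= []; rewrite ballEmdist /= => xy kn.
    have := metric_triangle x0 x y; have : k%:R <= n%:R :> R by rewrite ler_nat.
    lra.
  by move=> /filter_ex[M]; exists M.
apply: hproper; first exact: closed_closure.
exists ((M + 1) + (M + 1)) => x y /(mdist_closure_le AM) x1 /(mdist_closure_le AM) y1.
apply: le_trans (metric_triangle _ x0 _) _.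
by rewrite (metric_sym x) lerD.
Qed.

Lemma not_relatively_compactP (A : set X) :
  ~ relatively_compact A <-> forall r : R, exists2 x, A x & r < mdist x0 x.
Proof.
rewrite relatively_compactP; split=> [h r|h [M HM]].
  apply: contrapT => nr; apply: h; exists r => x Ax.
  by rewrite leNgt; apply/negP => rx; apply: nr; exists x.
by have [x /HM] := h M; rewrite leNgt => /negP.
Qed.

Lemma relatively_compact_bornology : is_bornology (@relatively_compact X).
Proof.
split.
- by move=> x; apply/relatively_compactP; exists (mdist x0 x) => _ ->.
- move=> A C AC /relatively_compactP[M CM]; apply/relatively_compactP.
  by exists M => x /AC /CM.
- by apply/relatively_compactP; exists 0.
- move=> A C /relatively_compactP[M AM] /relatively_compactP[N CN].
  apply/relatively_compactP; exists (Num.max M N) => x.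
  by rewrite le_max => -[/AM ->|/CN ->]//; rewrite orbT.
Qed.

End Compact.

Section VisualProximity.
Context (R : realType) (X : metricType R) (x0 : X)
  (hproper : proper_metric X) (hcat0 : cat0 X).
Local Notation fellow := (fellow_travel x0).
Local Notation ray eta := (path_of (ray_incl eta)).
Local Notation pt x := (path_of (point_incl x0 x)).

(** The points at time [u] of the geodesics to the [f i] eventually lie in a
    closed ball, which is compact, hence converge along [U] to some [a u]; the
    distances between such points pass to the limit, so [a] is a ray. *)
Lemma ultralimit_ray (I : Type) (U : set_system I) (f : I -> X) :
  UltraFilter U -> (forall r, U [set i | r <= mdist x0 (f i)]) ->
  exists eta : visual_boundary x0,
    forall r, 0 < r -> U [set i | fellow r (pt (f i)) (ray eta)].
Proof.
move=> UU Ufar.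
have limits : forall u : {nonneg R},
    exists p : X, (fun i => pt (f i) u%:num) @ U --> p.
  move=> u; pose B := [set y : X | mdist x0 y <= u%:num].
  have Bc : compact (closure B).
    by apply/(relatively_compactP x0 hproper); exists u%:num.
  move: Bc; rewrite compact_ultra.
  move=> /(_ ((fun i => pt (f i) u%:num) @ U) (ultra_fmap _ UU))[|p [_ pU]].
    suff : U [set i | closure B (pt (f i) u%:num)] by [].
    apply: filterS (Ufar u%:num) => i ui; apply: subset_closure.
    have g : geodesic_upto x0 u%:num (pt (f i)) by apply/geodesic_to_upto.
    by rewrite /B /= (geodesic_upto_dist g) ?lexx ?andbT.
  by exists p.
have [a aP] := choice limits.
have near_a u e : 0 < e -> U [set i | mdist (a u) (pt (f i) u%:num) < e].
  by move=> e0; exact: metricType_numDomainType.cvgr_dist_lt (aP u) _ e0.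
have aray : is_ray x0 a.
  split.
    apply/esym/mdist_positivity/le_anti; rewrite mdist_ge0 andbT.
    apply/ler_addgt0Pl => e e0; rewrite addr0.
    have [i] := filter_ex (near_a 0%:nng e e0).
    have [_ g0 _ _] := geodesic_toP x0 hcat0 (f i).
    by rewrite /= g0 metric_sym => /ltW.
  move=> s t; apply/eqP; rewrite -subr_eq0 -normr_le0.
  apply/ler_addgt0Pl => e e0; rewrite addr0.
  have e20 : 0 < e / 2 by rewrite divr_gt0.
  have [i [[[/= si ti] fs] ft]] := filter_ex (filterI (filterI
    (filterI (near_a s _ e20) (near_a t _ e20)) (Ufar s%:num)) (Ufar t%:num)).
  have := geodesic_toP x0 hcat0 (f i).
  move: si ti; rewrite -[geodesic_to _ _]/(pt (f i)) => si ti [_ _ _].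
  move=> /(_ s%:num t%:num); rewrite fs ft !ge0 => /(_ isT isT).
  move: si ti; set p := path_of _ s%:num; set q := path_of _ t%:num.
  move=> asp atq st; have := metric_triangle (a s) p (a t).
  have := metric_triangle p q (a t); have := metric_triangle p (a s) q.
  have := metric_triangle (a s) (a t) q.
  by rewrite st (metric_sym q (a t)) (metric_sym p (a s)) => *; rewrite ler_norml; lra.
pose eta : visual_boundary x0 := exist _ a aray.
exists eta => r r0; apply: filterS (filterI (Ufar r) (near_a `|r|%:nng 1 ltr01)).
move=> i [/= ri d]; split.
- by apply/geodesic_to_upto => //; exact: ltW.
- exact: (ray_upto eta (ltW r0)).
- move: d; rewrite metric_sym; congr (mdist (geodesic_to x0 (f i) _) _ < _).
  exact: gtr0_norm.
Qed.

(** * The visual proximity is a coarse proximity *)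

Lemma cvg_rayP (T : Type) (F : set_system T) {FF : Filter F} (x : T -> X)
    (eta : visual_boundary x0) :
  ((fun i => point_incl x0 (x i)) @ F --> ray_incl eta) <->
  forall r, 0 < r -> F [set i | fellow r (pt (x i)) (ray eta)].
Proof.
split=> [xeta r r0|h A].
  apply: (xeta [set xi | fellow r (path_of xi) (ray eta)]).
  by apply/(nbhs_rayP hcat0); exists r.
move=> /(nbhs_rayP hcat0)[r r0 rA].
by apply: filterS (h r r0) => i; exact: rA.
Qed.

(** For the converse, pick for each [n] a pair that fellow-travels up to
    [n + 1]; the limit ray of the first components along an ultrafilter is
    followed, by transitivity, by both components of a subsequence. *)
Lemma visual_proximityP (A B : set X) : visual_proximity x0 A B <->
  forall r, 0 < r -> exists a b, [/\ A a, B b & fellow r (pt a) (pt b)].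
Proof.
split=> [[x [y [eta [Ax By xeta yeta]]]] r r0|h].
  have r20 : 0 < 2 * r by rewrite mulr_gt0.
  have /cvg_rayP/(_ _ r20) xr := xeta.
  have /cvg_rayP/(_ _ r20) yr := yeta.
  have [n [/= xn yn]] := filter_ex (filterI xr yr).
  exists (x n), (y n); split=> //.
  exact: fellow_travel_trans xn (fellow_travel_sym yn).
have pairs : forall n : nat, exists ab : X * X,
    [/\ A ab.1, B ab.2 & fellow n.+1%:R (pt ab.1) (pt ab.2)].
  by move=> n; have [a [b abn]] := h n.+1%:R (ltr0Sn _ _); exists (a, b).
have [ab abP] := choice pairs.
have [U [UU ooU]] := @ultraFilterLemma nat \oo _.
have tail (r : R) : U [set n | r <= n.+1%:R].
  apply: ooU; exists (Num.bound `|r|) => // n /= rn.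
  apply: le_trans (ler_norm r) _; apply: ltW.
  apply: lt_le_trans (archi_boundP (normr_ge0 r)) _.
  by rewrite ler_nat (leq_trans rn).
have afar (r : R) : U [set n | r <= mdist x0 (ab n).1].
  apply: filterS (tail r) => n /= rn; apply: le_trans rn _.
  have [_ _ [g _ _]] := abP n.
  by apply/(geodesic_to_upto x0 hcat0).
have [eta etaP] := ultralimit_ray UU afar.
have indices : forall k : nat, exists n,
    fellow (2 * k.+1%:R) (pt (ab n).1) (ray eta) /\
    fellow (2 * k.+1%:R) (pt (ab n).2) (pt (ab n).1).
  move=> k; have k0 : 0 < 2 * k.+1%:R :> R by rewrite mulr_gt0.
  have [n [/= an kn]] := filter_ex (filterI (etaP _ k0) (tail (2 * k.+1%:R))).
  exists n; split=> //; apply: fellow_travel_sym.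
  have [_ _] := abP n; apply: (fellow_travel_le hcat0).
  by rewrite k0.
have [n nP] := choice indices.
exists (fun k => (ab (n k)).1), (fun k => (ab (n k)).2), eta.
have evk (P : nat -> R -> Prop) : (forall k, P k k.+1%:R) ->
    (forall k r s, 0 < r <= s -> P k s -> P k r) ->
    forall r, 0 < r -> \forall k \near \oo, P k r.
  move=> Pk Ple r r0; exists (Num.bound r) => // k /= rk.
  apply: Ple (Pk k); rewrite r0 /=; apply: ltW.
  by apply: lt_le_trans (archi_boundP (ltW r0)) _; rewrite ler_nat (leq_trans rk).
split; try by move=> k; have [] := abP (n k).
- apply/cvg_rayP; apply: evk => [k|k r s]; last exact: fellow_travel_le.
  have [f _] := nP k; apply: (fellow_travel_le hcat0 _ f).
  by rewrite ltr0Sn ler_peMl// ler1n.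
- apply/cvg_rayP; apply: evk => [k|k r s]; last exact: fellow_travel_le.
  by have [fa fb] := nP k; exact: fellow_travel_trans fb fa.
Qed.

(** Once the proximity is expressed by fellow-travelling, its union axiom is
    the monotonicity in the scale, and its strong axiom is the halving of the
    scale under composition. *)
Theorem visual_coarse_proximity :
  coarse_proximity_space (@relatively_compact X) (visual_proximity x0).
Proof.
have far r x y : 0 < r -> fellow r (pt x) (pt y) ->
    r <= mdist x0 x /\ r <= mdist x0 y.
  move=> /ltW r0 [gx gy _].
  by split; apply/(geodesic_to_upto x0 hcat0).
have symm A C : visual_proximity x0 A C -> visual_proximity x0 C A.
  by move=> [x [y [eta [Ax By xeta yeta]]]]; exists y, x, eta.
have unbdd A C : visual_proximity x0 A C -> ~ relatively_compact A.
  move=> /visual_proximityP h; apply/(not_relatively_compactP x0 hproper) => r.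
  have r0 : 0 < `|r| + 1 by rewrite ltr_wpDl.
  have [a [b [Aa _ /(@far _ _ _ r0)[ra _]]]] := h _ r0.
  exists a => //; apply: lt_le_trans ra; apply: le_lt_trans (ler_norm r) _.
  by rewrite ltrDl.
split=> //.
- exact: relatively_compact_bornology.
- by move=> A C bAC; split; [exact: unbdd bAC | exact: (unbdd _ _ (symm _ _ bAC))].
- move=> A C /(not_relatively_compactP x0 hproper) h.
  apply/visual_proximityP => r r0.
  have [x [Ax Cx] /ltW rx] := h r; exists x, x; split=> //.
  by apply/fellow_travel_refl/geodesic_to_upto => //; exact: ltW.
- move=> A C D; split; last first.
    move=> [] [x [y [eta [Ax Dy xeta yeta]]]]; exists x, y, eta; split=> // n.
      by left.
    by right.
  move=> /visual_proximityP h; apply: contrapT => /not_orP[].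
  move=> /visual_proximityP/existsNP[r /not_implyP[r0 nA]].
  move=> /visual_proximityP/existsNP[s /not_implyP[s0 nC]].
  have m0 : 0 < Num.max r s by rewrite lt_max r0.
  have [x [y [ACx Dy f]]] := h _ m0.
  case: ACx => [Ax|Cx]; [apply: nA|apply: nC]; exists x, y; split=> //;
    apply: fellow_travel_le f => //; by rewrite ?r0 ?s0 le_max lexx ?orbT.
- move=> A C /visual_proximityP/existsNP[r /not_implyP[r0 nAC]].
  have r20 : 0 < 2 * r by rewrite mulr_gt0.
  exists [set x | exists2 c, C c & fellow (2 * r) (pt x) (pt c)]; split.
    move=> /visual_proximityP/(_ _ r20)[a [x [Aa [c Cc xc] ax]]].
    by apply: nAC; exists a, c; split=> //; exact: fellow_travel_trans ax xc.
  by move=> /visual_proximityP/(_ _ r20)[x [c [nx Cc xc]]]; apply: nx; exists c.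
Qed.

End VisualProximity.

(** * Clusters and the Smirnov topology *)

Section Clusters.
Context (T : Type) (delta : set T -> set T -> Prop)
  (h : separated_proximity delta).

(** A cluster near the set of all the clusters that contain [A] has all its
    members close to [A], hence contains [A]. *)
Lemma open_avoiding_set (A : set T) :
  open [set sigma : smirnov h | ~ sval sigma A].
Proof.
move=> sigma near_sigma sA; apply: sA; apply: (cluster_max (svalP sigma)) => C sC.
by apply: near_sigma => [tau|_ ->//]; exact: contrapT.
Qed.

(** Together with [open_avoiding_set], this says that the sets of clusters that
    avoid a given set form a basis of the topology. *)
Lemma nbhs_avoids_set (sigma : smirnov h) (O : set (smirnov h)) :
  open O -> O sigma -> exists2 A, ~ sval sigma A &
    [set tau : smirnov h | ~ sval tau A] `<=` O.
Proof.
move=> oO Os.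
have /existsNP[A /existsNP[C /not_implyP[OA /not_implyP[sC AC]]]] :
  ~ smirnov_prox (~` O) [set sigma] by move=> /oO; exact.
exists A => [sA|tau tA].
  by apply: AC; apply: (cluster_near (svalP sigma)) sA _; exact: sC.
by apply: contrapT => /OA.
Qed.

Lemma cluster_subset_eq (sigma tau : set (set T)) :
  Defs.cluster delta sigma -> Defs.cluster delta tau -> sigma `<=` tau -> sigma = tau.
Proof.
move=> cs ct st; apply/seteqP; split=> // A tA.
by apply: (cluster_max cs) => C /st; exact: (cluster_near ct).
Qed.

(** The complements of the sets outside a cluster form a filter, because a
    cluster contains one of the terms of any union it contains; an ultrafilter
    that refines it cannot contain a set outside the cluster. *)
Lemma cluster_ultrafilter (sigma : set (set T)) : Defs.cluster delta sigma ->
  sigma setT -> exists U : set_system T, UltraFilter U /\ U `<=` sigma.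
Proof.
move=> cs sT; have [hd _] := h.
pose F := [set A | ~ sigma (~` A)].
have FF : ProperFilter F.
  split; first by rewrite /F /= setC0.
  split.
  - rewrite /F /= setCT => s0.
    by have [[]] := prox_neq0 hd (cluster_near cs s0 s0).
  - by move=> A C FA FC; rewrite /F /= setCI => /(cluster_union cs)[].
  - move=> A C AC FA sC; apply: FA; apply: (cluster_up hd cs) sC.
    exact: subsetC.
have [U [UU FU]] := ultraFilterLemma FF.
exists U; split=> // A UA; apply: contrapT => sA.
have UA' : U (~` A) by apply: FU; rewrite /F /= setCK.
by have [t []] := filter_ex (filterI UA UA').
Qed.

End Clusters.

(** * The boundary of the visual coarse proximity *)

Section Boundary.
Context (R : realType) (X : metricType R) (x0 : X)
  (hproper : proper_metric X) (hcat0 : cat0 X)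
  (h : coarse_proximity_space (@relatively_compact X) (visual_proximity x0)).
Local Notation fellow := (fellow_travel x0).
Local Notation ray eta := (path_of (ray_incl eta)).
Local Notation pt x := (path_of (point_incl x0 x)).
Local Notation delta := (discrete_extension (visual_proximity x0)).
Local Notation hdelta := (discrete_extension_separated h).
Implicit Types (r : R) (eta alpha : visual_boundary x0).

Lemma nbhs_boundaryP eta (W : set (visual_boundary x0)) : nbhs eta W <->
  exists2 r, 0 < r & forall alpha, fellow r (ray alpha) (ray eta) -> W alpha.
Proof.
split=> [|[r r0 rW]].
  rewrite nbhsE => -[_ [[C oC <-] Ceta] CW].
  have /(nbhs_rayP hcat0)[r r0 rC] : nbhs (ray_incl eta) C.
    exact: open_nbhs_nbhs.
  by exists r => // alpha /rC /CW.
pose C := [set xi : visual_compactification x0 | fellow r (path_of xi) (ray eta)].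
have nC : nbhs (ray_incl eta) C by apply/(nbhs_rayP hcat0); exists r.
have nC' : nbhs eta (@ray_incl R X x0 @^-1` C) := initial_continuous nC.
by apply: filterS nC' => alpha; exact: rW.
Qed.

Definition direction_cluster eta : set (set X) :=
  [set A | forall r, 0 < r -> exists2 a, A a & fellow r (pt a) (ray eta)].

(** A basic neighbourhood of [eta], traced on [X]. *)
Definition cone eta r : set X := [set x | fellow r (pt x) (ray eta)].

Lemma fellow_ray_far eta r s : 0 < r <= s ->
  fellow r (pt (ray eta s)) (ray eta).
Proof.
move=> /andP[r0 rs]; have s0 := le_trans (ltW r0) rs.
have g : geodesic_upto x0 r (pt (ray eta s)).
  apply/geodesic_to_upto => //; first exact: ltW.
  by rewrite (geodesic_upto_dist (ray_upto eta s0))// s0 lexx.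
split=> //; first by apply: ray_upto; exact: ltW.
by rewrite (geodesic_to_ray hcat0) ?(ltW r0)// mdistxx.
Qed.

Lemma cone_direction_cluster eta r : 0 < r -> direction_cluster eta (cone eta r).
Proof.
move=> r0 s s0; exists (ray eta (Num.max r s)); apply: fellow_ray_far.
  by rewrite r0 le_max lexx.
by rewrite s0 le_max lexx orbT.
Qed.

Lemma direction_clusterN eta A : ~ direction_cluster eta A ->
  exists2 r, 0 < r & forall a, A a -> ~ fellow r (pt a) (ray eta).
Proof.
move=> /existsNP[r /not_implyP[r0 nA]]; exists r => // a Aa f.
by apply: nA; exists a.
Qed.

(** The cones around [eta] already detect the sets that have [eta] as a limit
    point; this is used both for the maximality of the cluster of [eta] and to
    find the ray of a given cluster. *)
Lemma cone_near_member eta (A : set X) :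
  (forall r, 0 < r -> delta A (cone eta r)) -> direction_cluster eta A.
Proof.
move=> Acone r r0; have r20 : 0 < 2 * r by rewrite mulr_gt0.
case: (Acone _ r20) => [[a [Aa ac]]|].
  exists a => //; apply: fellow_travel_le ac => //.
  by rewrite r0 ler_peMl ?ler1n ?ltW.
move=> /(visual_proximityP x0 hproper hcat0)/(_ _ r20)[a [c [Aa cc ac]]].
by exists a => //; exact: fellow_travel_trans ac cc.
Qed.

Lemma direction_cluster_cluster eta : Defs.cluster delta (direction_cluster eta).
Proof.
split.
- move=> A C Aeta Ceta; right; apply/(visual_proximityP x0 hproper hcat0) => r r0.
  have r20 : 0 < 2 * r by rewrite mulr_gt0.
  have [a Aa af] := Aeta _ r20; have [c Cc cf] := Ceta _ r20.
  exists a, c; split=> //.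
  exact: fellow_travel_trans af (fellow_travel_sym cf).
- move=> A Anear; apply: cone_near_member => r r0; apply: Anear.
  exact: cone_direction_cluster.
- move=> A C AC; apply: contrapT => /not_orP[/direction_clusterN[r r0 nA]].
  move=> /direction_clusterN[s s0 nC].
  have m0 : 0 < Num.max r s by rewrite lt_max r0.
  have [x [Ax|Cx] f] := AC _ m0.
    by apply: (nA _ Ax); apply: fellow_travel_le f => //; rewrite r0 le_max lexx.
  apply: (nC _ Cx); apply: fellow_travel_le f => //.
  by rewrite s0 le_max lexx orbT.
Qed.

Lemma direction_cluster_unbounded eta A :
  direction_cluster eta A -> ~ relatively_compact A.
Proof.
move=> Aeta; apply/(not_relatively_compactP x0 hproper) => r.
have r0 : 0 < `|r| + 1 by rewrite ltr_wpDl.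
have [a Aa [/geodesic_to_upto ra _ _]] := Aeta _ r0.
exists a => //; apply: lt_le_trans (ra hcat0 (ltW r0)).
by apply: le_lt_trans (ler_norm r) _; rewrite ltrDl.
Qed.

(** The cone around [eta] of scale [2 * r] meets every cone around [alpha], so
    the two rays fellow-travel up to every [r], which by contraction makes them
    equal at every time. *)
Lemma direction_cluster_inj eta alpha :
  direction_cluster eta = direction_cluster alpha -> eta = alpha.
Proof.
move=> e; apply: (@ray_eq _ _ x0) => t t0.
apply/mdist_positivity/le_anti; rewrite mdist_ge0 andbT.
apply/ler_addgt0Pl => d d0; rewrite addr0.
(* A scale for which the contraction gives a distance at most [t / r <= d]. *)
pose r := t + t / d + 1.
have td0 : 0 <= t / d by rewrite divr_ge0// ltW.
have r0 : 0 < r by rewrite /r; lra.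
have r20 : 0 < 2 * r by rewrite mulr_gt0.
have := cone_direction_cluster eta r20; rewrite e => /(_ _ r20)[x xe xa].
have f := fellow_travel_trans hcat0 r0 (fellow_travel_sym xe) xa.
have tr : 0 <= t <= r by rewrite /r; apply/andP; split; lra.
apply: le_trans (fellow_travel_dist hcat0 r0 tr f) _.
rewrite ler_pdivrMr// /r mulrDr mulrDr mulr1 (mulrC d (t / d)).
rewrite divfK ?gt_eqF//; have : 0 <= d * t by rewrite mulr_ge0// ltW.
by lra.
Qed.

(** The limit ray [eta] of an ultrafilter inside [sigma] has all its cones in
    [sigma], so every member of [sigma] is close to them. *)
Lemma direction_cluster_surj (sigma : set (set X)) : Defs.cluster delta sigma ->
  (forall A, sigma A -> ~ relatively_compact A) ->
  exists eta, sigma = direction_cluster eta.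
Proof.
move=> cs unbdd; have [hd _] := hdelta.
have sT : sigma setT.
  by have [|] := cluster_setC setT hd cs => //; exact: (cluster_up hd cs).
have [U [UU Us]] := cluster_ultrafilter hdelta cs sT.
have Ufar r : U [set x | r <= mdist x0 x].
  have [//|/Us/unbdd[]] := in_ultra_setVsetC [set x | r <= mdist x0 x] UU.
  apply/(relatively_compactP x0 hproper); exists r => x /negP.
  by rewrite -ltNge => /ltW.
have [eta etaP] := ultralimit_ray hproper hcat0 UU Ufar.
exists eta; apply: (cluster_subset_eq cs (direction_cluster_cluster eta)).
move=> A sA; apply: cone_near_member => r r0.
by apply: (cluster_near cs sA); apply: Us; exact: etaP.
Qed.

(** A cluster that avoids the complement of the cone of scale [2 * r] around
    [eta] contains that cone, so its ray fellow-travels with [eta] up to [r].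
    In the other direction, if [A] is not in the cluster of [eta] then no point
    of [A] fellow-travels with [eta] up to some [r], hence [A] is not in the
    cluster of any ray that fellow-travels with [eta] up to [2 * r]. *)
Lemma boundary_homeomorphic :
  homeomorphic (set_type (cp_boundary h)) (visual_boundary x0).
Proof.
pose Bd := set_type (cp_boundary h).
pose sg eta : smirnov hdelta := exist _ _ (direction_cluster_cluster eta).
have sgP eta : sg eta \in cp_boundary h.
  by apply: mem_set => A; exact: direction_cluster_unbounded.
pose g eta : Bd := exist _ (sg eta) (sgP eta).
have dir (s : Bd) : exists eta, sval (val s) = direction_cluster eta.
  apply: direction_cluster_surj; first exact: svalP (val s).
  exact: set_mem (valP s).
have [f fP] := choice dir.
have fK : cancel f g by move=> s; apply: val_inj; apply: eq_sig_hprop.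
have gK : cancel g f.
  by move=> eta; apply: direction_cluster_inj; rewrite -fP.
exists f, g; split=> //.
- move=> s W /nbhs_boundaryP[r r0 rW].
  have r20 : 0 < 2 * r by rewrite mulr_gt0.
  pose O := [set tau : smirnov hdelta | ~ sval tau (~` cone (f s) (2 * r))].
  have Os : nbhs (val s) O.
    apply: open_nbhs_nbhs; split; first exact: open_avoiding_set.
    by rewrite /O /= fP => /(_ _ r20)[x].
  have Os' : nbhs s ((val : Bd -> smirnov hdelta) @^-1` O).
    exact: initial_continuous Os.
  apply: filterS Os' => t Ot; apply: rW.
  have ct := svalP (val t); have [hd _] := hdelta.
  have [|//] := cluster_setC (cone (f s) (2 * r)) hd ct.
  rewrite fP => /(_ _ r20)[x xs xt].
  exact: fellow_travel_trans (fellow_travel_sym xt) xs.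
- move=> eta W; rewrite nbhsE => -[_ [[V oV <-] Veta] VW].
  have [A nA AV] := nbhs_avoids_set oV Veta.
  have [r r0 rA] := direction_clusterN nA.
  have r20 : 0 < 2 * r by rewrite mulr_gt0.
  apply/nbhs_boundaryP; exists (2 * r) => // alpha f_ae.
  apply: VW; apply: AV => /(_ _ r20)[a Aa fa].
  exact: rA Aa (fellow_travel_trans hcat0 r0 fa f_ae).
Qed.

End Boundary.

Theorem theorem7p6 (R : realType) (X : metricType R) (x0 : X)
  (hproper : proper_metric X) (hcomplete : complete_metric X)
  (hcat0 : cat0 X) :
  exists h : coarse_proximity_space (@relatively_compact X)
               (visual_proximity x0),
    homeomorphic (set_type (cp_boundary h)) (visual_boundary x0).
Proof.
exists (visual_coarse_proximity x0 hproper hcat0).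
exact: boundary_homeomorphic.
Qed.
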